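(* Let $p>1$, let $\mathcal{G}$ be a connected graph, let $\mathcal{H}_p$ be a generalized $p$-Laplacian on $\mathcal{G}$, and let $\lambda_1=\min_{f\in\mathcal{S}_p}\mathcal{R}_{\mathcal{H}_p}(f)$ be its first eigenvalue. Then: (1) $\lambda_1$ is simple and the corresponding eigenfunction $f_1$ (up to sign) is strictly positive, i.e. $f_1(u)>0$ for all $u\in V$; (2) if $g$ is an eigenfunction associated to an eigenvalue $\lambda$ of $\mathcal{H}_p$ and $g(u)>0$ for all $u\in V$, then $\lambda=\lambda_1$.
   Context: Let $\mathcal{G}=(V,E)$ be a finite undirected simple graph with positive node weights $\varrho:V\to\mathbb{R}_+$ and positive symmetric edge weights $\omega:E\to\mathbb{R}_+$; $v\sim u$ means that $uv\in E$. For $p>1$ put $\phi_p(x)=|x|^{p-2}x$ (with $\phi_p(0)=0$). Given real coefficients $\kappa_u$, $u\in V$, the generalized $p$-Laplacian is $(\mathcal{H}_p f)(u)=\sum_{v\sim u}\omega_{uv}\phi_p(f(u)-f(v))+\kappa_u\phi_p(f(u))$ for $f:V\to\mathbb{R}$. A nonzero $f$ is an eigenfunction with eigenvalue $\lambda\in\mathbb{R}$ if $(\mathcal{H}_pf)(u)=\lambda\varrho_u\phi_p(f(u))$ for all $u\in V$. Let $\mathcal{S}_p=\{f:V\to\mathbb{R}:\|f\|_p=1\}$ and $$\mathcal{R}_{\mathcal{H}_p}(f)=\frac{\sum_{uv\in E}\omega_{uv}|f(u)-f(v)|^p+\sum_{u\in V}\kappa_u|f(u)|^p}{\sum_{u\in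 V}\varrho_u|f(u)|^p}.$$ An eigenvalue is simple if it has a unique eigenfunction in $\mathcal{S}_p$ up to sign. *)

(* Defs.v *)
From HB Require Import structures.
From mathcomp Require Import all_boot all_order all_algebra.
From mathcomp Require Import all_classical all_reals all_analysis.
Set Implicit Arguments.
Unset Strict Implicit.
Unset Printing Implicit Defensive.
Import Order.TTheory GRing.Theory Num.Theory.
Local Open Scope classical_set_scope.
Local Open Scope ring_scope.

(* [omega] is total on [V * V]; only its values on adjacent pairs matter, so
   symmetry and positivity are required only there. *)
Record weighted_graph (R : realType) (V : finType) := WeightedGraph {
  adj : rel V;
  rho : V -> R;
  omega : V -> V -> R;
  adj_sym : symmetric adj;
  adj_irrefl : irreflexive adj;
  rho_gt0 : forall u, 0 < rho u;
  omega_sym : forall u v, adj u v -> omega u v = omega v u;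
  omega_gt0 : forall u v, adj u v -> 0 < omega u v
}.

Definition connected_graph (R : realType) (V : finType)
    (G : weighted_graph R V) : Prop :=
  (0 < #|V|)%N /\ forall u v, connect (adj G) u v.

(* At [x = 0] the factor [x] forces the value [0], whatever [0 `^ (p - 2)]. *)
Definition phi (R : realType) (p x : R) : R := `|x| `^ (p - 2) * x.

Definition p_laplacian (R : realType) (V : finType) (G : weighted_graph R V)
    (kappa : V -> R) (p : R) (f : V -> R) (u : V) : R :=
  \sum_(v | adj G u v) omega G u v * phi p (f u - f v) + kappa u * phi p (f u).

Definition eigenfunction (R : realType) (V : finType) (G : weighted_graph R V)
    (kappa : V -> R) (p lambda : R) (f : V -> R) : Prop :=
  f <> (fun=> 0) /\
  forall u, p_laplacian G kappa p f u = lambda * rho G u * phi p (f u).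

Definition pnorm (R : realType) (V : finType) (p : R) (f : V -> R) : R :=
  (\sum_(u : V) `|f u| `^ p) `^ p^-1.

Definition Sp (R : realType) (V : finType) (p : R) : set (V -> R) :=
  [set f | pnorm p f = 1].

(* Each undirected edge [uv] occurs as the two ordered pairs [(u, v)] and
   [(v, u)], with equal terms, hence the factor [1 / 2]. *)
Definition edge_energy (R : realType) (V : finType) (G : weighted_graph R V)
    (p : R) (f : V -> R) : R :=
  2^-1 * \sum_(u : V) \sum_(v | adj G u v) omega G u v * `|f u - f v| `^ p.

Definition rayleigh (R : realType) (V : finType) (G : weighted_graph R V)
    (kappa : V -> R) (p : R) (f : V -> R) : R :=
  (edge_energy G p f + \sum_(u : V) kappa u * `|f u| `^ p) /
  \sum_(u : V) rho G u * `|f u| `^ p.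

Definition lambda1 (R : realType) (V : finType) (G : weighted_graph R V)
    (kappa : V -> R) (p : R) : R :=
  inf (rayleigh G kappa p @` Sp p).

Definition simple_eigenvalue (R : realType) (V : finType)
    (G : weighted_graph R V) (kappa : V -> R) (p lambda : R) : Prop :=
  exists f : V -> R,
    [/\ Sp p f, eigenfunction G kappa p lambda f &
        forall g : V -> R, Sp p g -> eigenfunction G kappa p lambda g ->
          g = f \/ g = (fun u => - f u)].

(* Main.v *)
Require Import Defs.
From HB Require Import structures.
From mathcomp Require Import all_boot all_order all_algebra.
From mathcomp Require Import all_classical all_reals all_analysis.
From mathcomp Require Import ring lra.
Set Implicit Arguments.
Unset Strict Implicit.
Unset Printing Implicit Defensive.
Import Order.TTheory GRing.Theory Num.Theory.
Import numFieldNormedType.Exports.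
Local Open Scope classical_set_scope.
Local Open Scope ring_scope.

(** The first eigenvalue is the smallest [lam] for which the functional
    [excess lam f], the energy of [f] minus [lam] times its weighted [p]-th
    power sum, takes a nonpositive value on some nonzero [f].  Up to the factor
    [p] its differential at [f] is [residual lam f], the defect of [f] in the
    eigenvalue equation, and by Euler's identity [excess lam f] is the pairing
    of [residual lam f] with [f].  Hence eigenfunctions are zeros of [excess],
    and conversely a nonzero [f] with [excess lam f = 0] is an eigenfunction as
    soon as [excess lam] is nonnegative ([excess_min_residual]: differentiate in
    the direction of the residual itself).  The minimum of the Rayleigh quotient exists by
    compactness of the sphere, so [excess] is nonnegative at [lambda1] and
    the [lambda1]-eigenfunctions, the ground states, are its nonzero zeros.

    Replacing [f] by [|f|] does not increase the energy, so [|f|] is a ground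
    state together with [f].  At a vertex where a nonnegative eigenfunction
    vanishes, the equation forces it to vanish at all neighbours; by
    connectedness a ground state has no zero.  If it changed sign along an edge,
    taking absolute values would strictly decrease the energy, so it has
    constant sign ([ground_sign]).

    Uniqueness, and the fact that no other eigenvalue has a positive
    eigenfunction, both come from a discrete Picone identity.  Let
    [g > 0] be an eigenfunction for [lam] and write a nonnegative function as
    [g * r].  Testing the equation of [g] against [g * r ^ p] turns
    [excess lam (g * r)] into a sum over the edges of terms which are
    nonnegative, and positive unless [r] takes equal values at the two ends
    ([picone_lt], a consequence of the strict convexity of the [p]-th power).
    So [excess lam] is nonnegative everywhere, which forces [lam = lambda1], and
    it vanishes only on multiples of [g]. *)

(** * Powers and the Picone inequality *)

Section Power.
Context {R : realType}.
Implicit Types p x y a b r q t : R.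

Lemma phi0 p : phi p 0 = 0.
Proof. by rewrite /phi mulr0. Qed.

Lemma phiN p x : phi p (- x) = - phi p x.
Proof. by rewrite /phi normrN mulrN. Qed.

Lemma phi_pos p x : 0 < x -> phi p x = x `^ (p - 1).
Proof.
move=> x0; rewrite /phi gtr0_norm// -{2}(powRr1 (ltW x0)) -powRD.
  by congr (_ `^ _); lra.
by rewrite (gt_eqF x0) implybT.
Qed.

Lemma phi_mul p x : p != 0 -> phi p x * x = `|x| `^ p.
Proof.
move=> p0; have [->|x0] := eqVneq x 0; first by rewrite mulr0 normr0 powR0.
rewrite /phi -mulrA -expr2 -real_normK ?num_real// -powR_mulrn// -powRD.
  by congr (_ `^ _); lra.
by rewrite normr_eq0 x0 implybT.
Qed.

Lemma phi_gt0 p x : 0 < x -> 0 < phi p x.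
Proof. by move=> x0; rewrite phi_pos// powR_gt0. Qed.

Lemma ln_lt_subr1 x : 0 < x -> x != 1 -> ln x < x - 1.
Proof.
move=> x0 x1; have l0 : ln x != 0 by rewrite ln_eq0.
by have := expR_gt1Dx l0; rewrite lnK ?posrE//; lra.
Qed.

(** Strict Bernoulli inequality.  With [s = 1 + p (t - 1)], the number [t] is the
    average of [s] and [1] with weights [1 / p] and [1 - 1 / p], so for [s > 0]
    this is the strict concavity of [ln]; that in turn is read off from the
    tangent bound [ln x <= x - 1] at [x = s / t] and [x = 1 / t]. *)
Lemma powR_gt_tangent1 p t : 1 < p -> 0 <= t -> t != 1 -> 1 + p * (t - 1) < t `^ p.
Proof.
move=> p1 t0 t1; have p0 : 0 < p by lra.
have [s0|s0] := leP (1 + p * (t - 1)) 0.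
  have [te|tn] := eqVneq t 0; last first.
    by apply: le_lt_trans s0 _; rewrite powR_gt0// lt_neqAle eq_sym tn.
  by rewrite te powR0 ?gt_eqF//; lra.
set s := 1 + _ in s0 *.
have tgt0 : 0 < t.
  by rewrite lt_neqAle t0 andbT eq_sym; apply: contraTneq s0 => te; rewrite /s te; lra.
rewrite -ltr_ln ?posrE ?powR_gt0// ln_powR.
have H1 : ln (t^-1) < t^-1 - 1 by apply: ln_lt_subr1; rewrite ?invr_gt0 ?invr_eq1.
have H2 : ln (s / t) <= s / t - 1.
  have st0 : 0 < s / t by rewrite divr_gt0.
  by have := @le_ln1Dx R (s / t - 1); rewrite (addrC 1) subrK; apply; lra.
rewrite lnV ?posrE// in H1; rewrite lnM ?posrE ?invr_gt0// lnV ?posrE// in H2.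
have E : s / t = t^-1 + p - p * t^-1 by rewrite /s; field; rewrite gt_eqF.
nra.
Qed.

Lemma powR_gt_tangent p q r : 1 < p -> 0 <= q -> 0 <= r -> q != r ->
  r `^ p + p * r `^ (p - 1) * (q - r) < q `^ p.
Proof.
move=> p1 q0 r0 qr; have [re|rn] := eqVneq r 0.
  rewrite re in qr *; rewrite !powR0 ?gt_eqF//; [|lra..].
  by rewrite mulr0 mul0r addr0 powR_gt0// lt_neqAle eq_sym qr.
have {rn r0}r0 : 0 < r by rewrite lt_neqAle eq_sym rn.
have qE : q = r * (q / r) by rewrite mulrCA mulfV ?mulr1// gt_eqF.
have t1 : q / r != 1 by apply: contra_neq qr => e; rewrite qE e mulr1.
have := powR_gt_tangent1 p1 (divr_ge0 q0 (ltW r0)) t1.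
rewrite -(ltr_pM2l (powR_gt0 p r0)) -powRM ?divr_ge0 ?(ltW r0)// -qE.
apply: le_lt_trans.
rewrite -(mulr_powRB1 (ltW r0) (_ : 0 < p)); last by lra.
rewrite le_eqVlt; apply/orP; left; apply/eqP; field.
by rewrite gt_eqF.
Qed.

Lemma powR_ge_tangent p q r : 1 < p -> 0 <= q -> 0 <= r ->
  r `^ p + p * r `^ (p - 1) * (q - r) <= q `^ p.
Proof.
move=> p1 q0 r0; have [->|qr] := eqVneq q r; first by rewrite subrr mulr0 addr0.
exact/ltW/powR_gt_tangent.
Qed.

(** Put [d = a - b] and [e = |a r - b q| / d].  As [a = b + d] and
    [b q + d e >= a r], convexity, in the form of the tangent at [r] evaluated at
    [q] with weight [b] and at [e] with weight [d], gives
    [a r ^ p <= b q ^ p + d e ^ p], strictly because [q] differs from [r].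
    Multiplying by [d ^ (p - 1)] yields the claim. *)
Lemma picone_lt_of_gt p a b r q : 1 < p -> 0 < b -> b < a -> 0 <= r -> 0 <= q ->
  r != q -> phi p (a - b) * (a * r `^ p - b * q `^ p) < `|a * r - b * q| `^ p.
Proof.
move=> p1 b0 ba r0 q0 rq; have d0 : 0 < a - b by lra.
set d := a - b in d0 *; pose e := `|a * r - b * q| / d.
have e0 : 0 <= e by rewrite divr_ge0// ltW.
have se : `|a * r - b * q| = d * e by rewrite /e mulrCA mulfV ?mulr1// gt_eqF.
rewrite se powRM// ?(ltW d0)// -{2}(gtr0_norm d0) -phi_mul ?gt_eqF//; last by lra.
rewrite -mulrA ltr_pM2l ?phi_gt0//.
have := powR_ge_tangent p1 e0 r0; have := @powR_gt_tangent p q r p1 q0 r0.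
rewrite eq_sym rq => /(_ isT).
have := ler_norm (a * r - b * q); rewrite se.
have : 0 <= p * r `^ (p - 1) by rewrite mulr_ge0 ?powR_ge0//; lra.
set m := p * _; set P := r `^ p; set Q := q `^ p; set E := e `^ p.
move=> m0 H1 H2 H3.
have H4 : b * (P + m * (q - r)) < b * Q by rewrite ltr_pM2l.
have H5 : d * (P + m * (e - r)) <= d * E by rewrite ler_pM2l.
have H6 : m * (a * r - b * q) <= m * (d * e) by rewrite ler_wpM2l.
have aE : a = b + d by rewrite /d; lra.
by move: H4 H5 H6; rewrite aE; lra.
Qed.

Lemma picone_lt p a b r q : 1 < p -> 0 < a -> 0 < b -> 0 <= r -> 0 <= q ->
  r != q -> phi p (a - b) * (a * r `^ p - b * q `^ p) < `|a * r - b * q| `^ p.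
Proof.
move=> p1 a0 b0 r0 q0 rq; case: (ltgtP a b) => [ab|ab|<-].
- rewrite distrC -(opprB b a) phiN mulNr -mulrN opprB.
  by apply: picone_lt_of_gt; rewrite // eq_sym.
- exact: picone_lt_of_gt.
rewrite subrr phi0 mul0r powR_gt0// normr_gt0 -mulrBr.
by rewrite mulf_neq0 ?subr_eq0// gt_eqF.
Qed.

Lemma picone_eq p a b r : 1 < p -> 0 <= r ->
  phi p (a - b) * (a * r `^ p - b * r `^ p) = `|a * r - b * r| `^ p.
Proof.
move=> p1 r0; rewrite -!mulrBl mulrA phi_mul; last by rewrite gt_eqF//; lra.
by rewrite normrM (ger0_norm r0) powRM.
Qed.

Lemma picone_le p a b r q : 1 < p -> 0 < a -> 0 < b -> 0 <= r -> 0 <= q ->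
  phi p (a - b) * (a * r `^ p - b * q `^ p) <= `|a * r - b * q| `^ p.
Proof.
move=> p1 a0 b0 r0 q0; have [->|rq] := eqVneq r q; first by rewrite picone_eq.
exact/ltW/picone_lt.
Qed.

(** The difference quotient at [0] is bounded by [|h| ^ (p - 1)]; this is where
    [p > 1], and not just [p > 0], makes the functional differentiable. *)
Lemma is_derive_norm_powR0 p : 1 < p -> is_derive (0 : R) 1 (fun y => `|y| `^ p) 0.
Proof.
move=> p1; have p10 : 0 < p - 1 by lra.
suff H : h^-1 *: (`|h *: (1 : R) + 0| `^ p - `|0 : R| `^ p) @[h --> (0:R)^'] --> (0 : R).
  by apply: DeriveDef; [apply/cvg_ex; exists 0|apply/cvg_lim].
apply/cvgr0Pnorm_lt => e e0.
have d0 : 0 < e `^ (p - 1)^-1 by rewrite powR_gt0.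
near=> h.
have h0 : h != 0 by near: h; exact: nbhs_dnbhs_neq.
rewrite normr0 powR0 ?gt_eqF//; last by lra.
rewrite subr0 addr0 /GRing.scale/= mulr1 normrM normfV (ger0_norm (powR_ge0 _ _)).
rewrite -mulr_powRB1//; last by lra.
rewrite mulKf ?normr_eq0//.
have hd : `|h| < e `^ (p - 1)^-1.
  by near: h; apply: dnbhs0_lt.
rewrite (lt_le_trans (gt0_ltr_powR p10 _ _ hd)) ?nnegrE ?powR_ge0//.
by rewrite -powRrM mulVf ?gt_eqF// powRr1// ltW.
Unshelve. all: by end_near. Qed.

Lemma is_derive_norm_powR p x : 1 < p ->
  is_derive x 1 (fun y => `|y| `^ p) (p * phi p x).
Proof.
move=> p1; case: (ltgtP x 0) => [x0|x0|->]; last first.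
- by rewrite phi0 mulr0; exact: is_derive_norm_powR0.
- rewrite phi_pos//; apply: near_eq_is_derive; last exact: is_derive1_powR.
  by near=> y; rewrite gtr0_norm//; near: y; exact: lt_nbhsr.
- have Nx0 : 0 < - x by rewrite oppr_gt0.
  have H : is_derive x 1 ((@powR R ^~ p) \o -%R) (p * phi p x).
    apply: is_derive_eq.
      by apply: is_derive1_comp; exact: is_derive1_powR.
    by rewrite -[x in phi p x]opprK phiN phi_pos// mulrN1 mulrN.
  apply: near_eq_is_derive H.
  by near=> y => /=; rewrite ltr0_norm//; near: y; exact: lt_nbhsl.
Unshelve. all: by end_near. Qed.

Lemma continuous_norm_powR p : 1 < p -> continuous (fun y : R => `|y| `^ p).
Proof.
move=> p1 x; apply/differentiable_continuous/derivable1_diffP.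
by have [] := is_derive_norm_powR x p1.
Qed.

End Power.

(** * Derivatives along lines *)

Section Analysis.
Context {R : realType}.

Lemma is_derive_scale (c : R) (F : R -> R) (dF x : R) :
  is_derive x 1 F dF -> is_derive x 1 (fun t => c * F t) (c * dF).
Proof. exact: is_deriveZ. Qed.

Lemma is_derive_bigsum (I : Type) (r : seq I) (P : pred I) (F : I -> R -> R)
    (dF : I -> R) (x : R) :
  (forall i, is_derive x 1 (F i) (dF i)) ->
  is_derive x 1 (fun t => \sum_(i <- r | P i) F i t) (\sum_(i <- r | P i) dF i).
Proof.
move=> dFi; rewrite (_ : (fun t => _) = \sum_(i <- r | P i) F i); last first.
  by apply/funext => t; rewrite fct_sumE.
by elim/big_ind2 : _ => // [|] *; [exact: is_derive_cst|exact: is_deriveD].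
Qed.

Lemma is_derive_norm_powR_line (p a b t : R) : 1 < p ->
  is_derive t 1 (fun s => `|a + s * b| `^ p) (p * (phi p (a + t * b) * b)).
Proof.
move=> p1; pose l (s : R) := a + s * b.
have dl : is_derive t 1 l b.
  have := is_deriveD (is_derive_cst a t 1) (is_derive_scale b (is_derive_id t 1)).
  rewrite add0r mulr1 (_ : _ + _ = l)//.
  by apply/funext => s; rewrite /l mulrC.
have H := is_derive_norm_powR (l t) p1.
by rewrite mulrA; exact: (is_derive1_comp (f := fun y : R => `|y| `^ p) (g := l)).
Qed.

End Analysis.

(** * The energy functional of a weighted graph *)

Section Graph.
Context {R : realType} {V : finType} (G : weighted_graph R V).
Context (kappa : V -> R) (p : R) (hp : 1 < p).
Implicit Types (f g h r : V -> R) (lam : R) (u v : V).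

Let p_neq0 : p != 0. Proof. by rewrite gt_eqF//; move: hp; lra. Qed.

Definition edge_sum (a : V -> V -> R) : R :=
  2^-1 * \sum_u \sum_(v | adj G u v) omega G u v * a u v.

Lemma edge_sum_le (a b : V -> V -> R) :
  (forall u v, adj G u v -> a u v <= b u v) -> edge_sum a <= edge_sum b.
Proof.
move=> ab; rewrite ler_pM2l ?invr_gt0//; apply: ler_sum => u _.
by apply: ler_sum => v uv; rewrite ler_pM2l ?omega_gt0// ab.
Qed.

Lemma edge_sum_eq (a b : V -> V -> R) :
  (forall u v, adj G u v -> a u v <= b u v) -> edge_sum a = edge_sum b ->
  forall u v, adj G u v -> a u v = b u v.
Proof.
move=> ab abE.
have term_ge0 u v : adj G u v -> 0 <= omega G u v * (b u v - a u v).
  by move=> uv; rewrite mulr_ge0 ?subr_ge0 ?ab// ltW// omega_gt0.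
have S0 : \sum_u \sum_(v | adj G u v) omega G u v * (b u v - a u v) = 0.
  under eq_bigr do (under eq_bigr do rewrite mulrBr; rewrite sumrB).
  by rewrite sumrB; move: abE; rewrite /edge_sum; lra.
move=> u v uv.
have Su : \sum_(v | adj G u v) omega G u v * (b u v - a u v) = 0.
  exact: (psumr_eq0P (fun u _ => sumr_ge0 _ (term_ge0 u)) S0).
have /eqP : omega G u v * (b u v - a u v) = 0.
  exact: (psumr_eq0P (term_ge0 u) Su).
by rewrite mulf_eq0 gt_eqF ?omega_gt0//= subr_eq0 => /eqP.
Qed.

(** Discrete Green formula: exchanging the two ends of every edge shows that
    both halves of the difference [h u - h v] contribute equally. *)
Lemma edge_sum_by_parts (F : V -> V -> R) h :
  (forall u v, adj G u v -> F v u = - F u v) ->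
  edge_sum (fun u v => F u v * (h u - h v)) =
  \sum_u (\sum_(v | adj G u v) omega G u v * F u v) * h u.
Proof.
move=> FN; set A := RHS.
have AE : A = \sum_u \sum_(v | adj G u v) omega G u v * F u v * h u.
  by apply: eq_bigr => u _; rewrite mulr_suml.
have BE : \sum_u \sum_(v | adj G u v) omega G u v * F u v * h v = - A.
  rewrite (exchange_big_dep xpredT)//= AE -sumrN; apply: eq_bigr => u _.
  rewrite -sumrN; apply: eq_big => [v|v vu]; first by rewrite adj_sym.
  by rewrite FN 1?adj_sym// omega_sym// mulrN mulNr.
rewrite /edge_sum.
under eq_bigr do (under eq_bigr do rewrite mulrA mulrBr; rewrite sumrB).
by rewrite sumrB BE -AE; lra.
Qed.

(** The Euler-Lagrange functional of the eigenvalue problem. *)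
Definition excess lam f : R :=
  edge_energy G p f + \sum_u kappa u * `|f u| `^ p
  - lam * \sum_u rho G u * `|f u| `^ p.

Definition residual lam f u : R :=
  p_laplacian G kappa p f u - lam * rho G u * phi p (f u).

Lemma excessE lam f : excess lam f =
  edge_sum (fun u v => `|f u - f v| `^ p) +
  \sum_u (kappa u - lam * rho G u) * `|f u| `^ p.
Proof.
rewrite /excess -addrA; congr (_ + _).
under [RHS]eq_bigr do rewrite mulrBl -mulrA.
by rewrite sumrB mulr_sumr.
Qed.

Lemma weak_form lam f h : \sum_u residual lam f u * h u =
  edge_sum (fun u v => phi p (f u - f v) * (h u - h v)) +
  \sum_u (kappa u - lam * rho G u) * (phi p (f u) * h u).
Proof.
rewrite edge_sum_by_parts; last by move=> u v _; rewrite -phiN opprB.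
rewrite -big_split/=; apply: eq_bigr => u _.
by rewrite /residual /p_laplacian; ring.
Qed.

Lemma excess_residual lam f : excess lam f = \sum_u residual lam f u * f u.
Proof.
rewrite weak_form excessE; congr (_ + _); last first.
  by apply: eq_bigr => u _; rewrite phi_mul.
congr (_ * _); apply: eq_bigr => u _; apply: eq_bigr => v _.
by rewrite phi_mul.
Qed.

(** First variation of [excess], at every point of the line so that the same
    statement also provides the differentiability needed at an interior
    minimum. *)
Lemma is_derive_excess lam f h (t : R) :
  is_derive t 1 (fun s => excess lam (fun u => f u + s * h u))
    (p * \sum_u residual lam (fun u => f u + t * h u) u * h u).
Proof.
have lineB s u v : f u + s * h u - (f v + s * h v) = f u - f v + s * (h u - h v).
  by ring.
have d1 : is_derive t 1
    (fun s => edge_sum (fun u v => `|f u - f v + s * (h u - h v)| `^ p))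
    (p * edge_sum (fun u v => phi p (f u - f v + t * (h u - h v)) * (h u - h v))).
  have -> : p * edge_sum (fun u v => phi p (f u - f v + t * (h u - h v)) * (h u - h v))
      = edge_sum (fun u v => p * (phi p (f u - f v + t * (h u - h v)) * (h u - h v))).
    rewrite /edge_sum mulrCA; congr (_ * _).
    rewrite mulr_sumr; apply: eq_bigr => u _; rewrite mulr_sumr.
    by apply: eq_bigr => v _; rewrite mulrCA.
  apply: is_derive_scale; apply: is_derive_bigsum => u.
  apply: is_derive_bigsum => v; apply: is_derive_scale.
  exact: is_derive_norm_powR_line.
have d2 : is_derive t 1
    (fun s => \sum_u (kappa u - lam * rho G u) * `|f u + s * h u| `^ p)
    (p * \sum_u (kappa u - lam * rho G u) * (phi p (f u + t * h u) * h u)).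
  rewrite mulr_sumr; under eq_bigr do rewrite mulrCA.
  apply: is_derive_bigsum => u; apply: is_derive_scale.
  exact: is_derive_norm_powR_line.
rewrite weak_form mulrDr; set F1 := (fun s => edge_sum _) in d1.
set F2 := (fun s => \sum_u _) in d2.
rewrite (_ : (fun s => _) = F1 + F2); last first.
  apply/funext => s; rewrite excessE; congr (_ + _).
  congr (_ * _); apply: eq_bigr => u _; apply: eq_bigr => v _.
  by rewrite lineB.
apply: is_derive_eq; congr (_ * _ + _).
congr (_ * _); apply: eq_bigr => u _; apply: eq_bigr => v _.
by rewrite lineB.
Qed.

(** Along the line through the minimizer [f] in the direction of its own
    residual, the derivative is [p] times the sum of the squared residuals. *)
Lemma excess_min_residual lam f : (forall g, 0 <= excess lam g) ->
  excess lam f = 0 -> forall u, residual lam f u = 0.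
Proof.
move=> ge0 f0.
have fE : (fun u => f u + 0 * residual lam f u) = f.
  by apply/funext => u; rewrite mul0r addr0.
have dmin : is_derive (0 : R) 1
    (fun t => excess lam (fun u => f u + t * residual lam f u)) 0.
  apply: (@derive1_at_min _ _ (-1) 1).
  - by lra.
  - by move=> t _; have [] := is_derive_excess lam f (residual lam f) t.
  - by rewrite in_itv/=; lra.
  - by move=> t _; rewrite fE f0.
have [_] := is_derive_excess lam f (residual lam f) 0.
have [_ ->] := dmin; rewrite fE => /esym/eqP.
rewrite mulf_eq0 (negbTE p_neq0)/= => /eqP S0 u.
have /eqP : residual lam f u ^+ 2 = 0.
  exact: (psumr_eq0P (fun u _ => sqr_ge0 (residual lam f u)) S0).
by rewrite sqrf_eq0 => /eqP.
Qed.

Lemma excess_scale lam c f : excess lam (fun u => c * f u) = `|c| `^ p * excess lam f.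
Proof.
rewrite !excessE mulrDr; congr (_ + _).
  rewrite /edge_sum mulrCA; congr (_ * _); rewrite mulr_sumr.
  apply: eq_bigr => u _; rewrite mulr_sumr; apply: eq_bigr => v _.
  by rewrite -mulrBr normrM powRM// mulrCA.
by rewrite mulr_sumr; apply: eq_bigr => u _; rewrite normrM powRM// mulrCA.
Qed.

Lemma dist_norm_lt (a b : R) : 0 < a -> b < 0 -> `| `|a| - `|b| | < `|a - b|.
Proof.
move=> a0 b0; rewrite (gtr0_norm a0) (ltr0_norm b0) (@gtr0_norm _ (a - b)).
  by rewrite ltr_norml; lra.
by lra.
Qed.

Lemma norm_powR_dist_dist (a b : R) : `| `|a| - `|b| | `^ p <= `|a - b| `^ p.
Proof.
by rewrite ge0_ler_powR ?nnegrE ?normr_ge0 ?ler_dist_dist//; move: hp; lra.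
Qed.

Lemma excess_normE lam f :
  excess lam f - excess lam (fun u => `|f u|) =
  edge_sum (fun u v => `|f u - f v| `^ p) -
  edge_sum (fun u v => `| `|f u| - `|f v| | `^ p).
Proof.
rewrite !excessE.
under [X in _ - (_ + X)]eq_bigr do rewrite normr_id.
by lra.
Qed.

Lemma excess_norm_le lam f : excess lam (fun u => `|f u|) <= excess lam f.
Proof.
rewrite -subr_ge0 excess_normE subr_ge0; apply: edge_sum_le => u v _.
exact: norm_powR_dist_dist.
Qed.

(** Only the edge terms change when [f] is replaced by [|f|] and each of them
    can only decrease, so equality holds edge by edge. *)
Lemma excess_norm_eq lam f : excess lam (fun u => `|f u|) = excess lam f ->
  forall u v, adj G u v -> `| `|f u| - `|f v| | = `|f u - f v|.
Proof.
move=> fE u v uv.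
have E : edge_sum (fun u v => `| `|f u| - `|f v| | `^ p) =
         edge_sum (fun u v => `|f u - f v| `^ p).
  by have := excess_normE lam f; rewrite fE; lra.
have := edge_sum_eq (fun u v _ => norm_powR_dist_dist (f u) (f v)) E uv.
by apply: powR_injective; rewrite ?nnegrE//; move: hp; lra.
Qed.

(** * Positive eigenfunctions *)

Section Connected.
Context (hG : connected_graph G).

Lemma connected_const (T : eqType) (a : V -> T) :
  (forall u v, adj G u v -> a u = a v) -> forall u v, a u = a v.
Proof.
move=> aE u v.
have cl : closed_mem (adj G) (mem [pred x | a x == a u]).
  by move=> x y /aE xy; rewrite !inE xy.
have := closed_connect cl (hG.2 u v).
by rewrite !inE eqxx => /esym/eqP.
Qed.

Section PositiveEigen.
Context (lam : R) (g : V -> R) (g_gt0 : forall u, 0 < g u).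
Context (g_res : forall u, residual lam g u = 0).

(** Discrete Picone identity: the equation of [g] is tested against
    [g * r ^ p], for which the zeroth order terms are those of [g * r]. *)
Lemma excess_picone r : (forall u, 0 <= r u) ->
  excess lam (fun u => g u * r u) =
  edge_sum (fun u v => `|g u * r u - g v * r v| `^ p) -
  edge_sum (fun u v => phi p (g u - g v) * (g u * r u `^ p - g v * r v `^ p)).
Proof.
move=> r0; have := weak_form lam g (fun u => g u * r u `^ p).
rewrite big1; last by move=> u _; rewrite g_res mul0r.
rewrite excessE.
have -> : \sum_u (kappa u - lam * rho G u) * (phi p (g u) * (g u * r u `^ p)) =
  \sum_u (kappa u - lam * rho G u) * `|g u * r u| `^ p.
  apply: eq_bigr => u _; congr (_ * _); rewrite mulrA phi_mul// normrM powRM//.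
  by rewrite (ger0_norm (r0 u)).
by move=> /esym; lra.
Qed.

Lemma positive_ratioE f : f = (fun u => g u * (f u / g u)).
Proof. by apply/funext => u; rewrite mulrCA mulfV ?mulr1// gt_eqF. Qed.

Lemma positive_excess_ge0 f : 0 <= excess lam f.
Proof.
apply: le_trans (excess_norm_le lam f).
rewrite (positive_ratioE (fun u => `|f u|)).
have r0 u : 0 <= `|f u| / g u by rewrite divr_ge0// ltW.
rewrite excess_picone// subr_ge0; apply: edge_sum_le => u v _.
by rewrite picone_le.
Qed.

Lemma positive_excess_eq0 f : (forall u, 0 <= f u) -> excess lam f = 0 ->
  forall u v, f u / g u = f v / g v.
Proof.
move=> f0 fE; apply: connected_const => u v uv.
have r0 u' : 0 <= f u' / g u' by rewrite divr_ge0// ltW.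
move: fE; rewrite [X in excess _ X]positive_ratioE excess_picone// => /eqP.
rewrite subr_eq0 => /eqP /esym E; apply/eqP/negPn/negP => ruv.
have := edge_sum_eq (fun u v _ => picone_le hp (g_gt0 u) (g_gt0 v) (r0 u) (r0 v)) E uv.
by have := picone_lt hp (g_gt0 u) (g_gt0 v) (r0 u) (r0 v) ruv; lra.
Qed.

End PositiveEigen.

(** * Ground states *)

Section Ground.
Context (lam : R) (lam_min : forall f, 0 <= excess lam f).

Lemma ground_norm f : excess lam f = 0 -> excess lam (fun u => `|f u|) = 0.
Proof.
by move=> f0; apply/eqP; rewrite eq_le lam_min andbT -f0 excess_norm_le.
Qed.

(** At a zero of [f], the eigenvalue equation of the ground state [|f|] says
    that a sum of nonnegative terms, one for each neighbour, is zero. *)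
Lemma ground_neq0 f : f <> (fun=> 0) -> excess lam f = 0 ->
  forall u, f u != 0.
Proof.
move=> fn0 /ground_norm/(excess_min_residual lam_min) res0.
have nbr u v : adj G u v -> f u = 0 -> f v = 0.
  move=> uv fu0; have := res0 u.
  rewrite /residual /p_laplacian fu0 normr0 phi0 !mulr0 subr0 addr0.
  under eq_bigr do rewrite sub0r phiN mulrN.
  rewrite sumrN => /eqP; rewrite oppr_eq0 => /eqP S0.
  have ge0 w : adj G u w -> 0 <= omega G u w * phi p `|f w|.
    move=> uw; rewrite mulr_ge0 ?(ltW (omega_gt0 uw))//.
    by rewrite /phi normr_id mulr_ge0 ?powR_ge0.
  have : omega G u v * phi p `|f v| = 0 by exact: (psumr_eq0P ge0 S0).
  apply: contra_eq => fv0.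
  by rewrite mulf_neq0 ?gt_eqF ?omega_gt0 ?phi_gt0 ?normr_gt0.
have cst : forall u v, (f u == 0) = (f v == 0).
  apply: connected_const => u v uv; apply/eqP/eqP; apply: nbr => //.
  by rewrite adj_sym.
move=> u; apply/negP => fu0; apply: fn0; apply/funext => v.
by apply/eqP; rewrite (cst v u).
Qed.

Lemma ground_sign f : f <> (fun=> 0) -> excess lam f = 0 ->
  (forall u, 0 < f u) \/ (forall u, 0 < - f u).
Proof.
move=> fn0 f0; have fneq0 := ground_neq0 fn0 f0.
have E := excess_norm_eq (etrans (ground_norm f0) (esym f0)).
have cst : forall u v, (0 < f u) = (0 < f v).
  apply: connected_const => u v uv.
  have /orP[fu|fu] : (f u < 0) || (0 < f u) by rewrite -neq_lt fneq0.
    have /orP[fv|fv] : (f v < 0) || (0 < f v) by rewrite -neq_lt fneq0.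
      by rewrite !ltNge !ltW.
    have := dist_norm_lt fv fu.
    by rewrite distrC (E u v uv) distrC ltxx.
  have /orP[fv|fv] : (f v < 0) || (0 < f v) by rewrite -neq_lt fneq0.
    by have := dist_norm_lt fu fv; rewrite (E u v uv) ltxx.
  by rewrite fu fv.
have [u0 _] : exists u : V, true by have [/card_gt0P[u]] := hG; exists u.
have [fu0|fu0] := ltP 0 (f u0); [left|right] => u.
  by rewrite (cst u u0).
by rewrite oppr_gt0 lt_neqAle fneq0/= leNgt (cst u u0) -leNgt.
Qed.

End Ground.
End Connected.
End Graph.

(** * Existence of a minimizer *)

Section Sphere.
Context {R : realType} {V : finType} (p : R) (hp : 1 < p).
Implicit Types (f g : V -> R).

Let p_gt0 : 0 < p. Proof. by move: hp; lra. Qed.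

Lemma SpE f : Sp p f <-> \sum_u `|f u| `^ p = 1.
Proof.
have S0 : 0 <= \sum_u `|f u| `^ p by apply: sumr_ge0 => u _; exact: powR_ge0.
rewrite /Sp/= /pnorm; split=> [e|->]; last by rewrite powR1.
rewrite -[LHS](powRr1 S0) -[X in _ `^ X](mulVf (lt0r_neq0 p_gt0)) powRrM e.
by rewrite powR1.
Qed.

Lemma sum_norm_powR_gt0 (w : V -> R) f : (forall u, 0 < w u) -> f <> (fun=> 0) ->
  0 < \sum_u w u * `|f u| `^ p.
Proof.
move=> w0 fn0.
have ge0 u : true -> 0 <= w u * `|f u| `^ p by rewrite mulr_ge0 ?powR_ge0// ltW.
rewrite lt_neqAle sumr_ge0// andbT eq_sym; apply/eqP => S0.
apply: fn0; apply/funext => u; apply/eqP.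
have /eqP : w u * `|f u| `^ p = 0 by exact: (psumr_eq0P ge0 S0).
by rewrite mulf_eq0 gt_eqF//= powR_eq0 normr_eq0 => /andP[].
Qed.

Lemma normalize f : f <> (fun=> 0) ->
  exists2 c, 0 < c & Sp p (fun u => c * f u).
Proof.
move=> /(@sum_norm_powR_gt0 (fun=> 1) _ (fun=> ltr01)).
under eq_bigr do rewrite mul1r.
set S := \sum_u _ => S0; exists (S `^ (- p^-1)); first by rewrite powR_gt0.
apply/SpE; under eq_bigr do rewrite normrM powRM// ger0_norm ?powR_ge0//.
rewrite -mulr_sumr -powRrM mulNr mulVf ?gt_eqF//.
by rewrite powR_inv1 ?ltW// mulVf// gt_eqF.
Qed.

Lemma Sp_neq0 f : Sp p f -> f <> (fun=> 0).
Proof.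
move=> /SpE + f0; rewrite f0 big1; last first.
  by move=> u _; rewrite normr0 powR0 ?gt_eqF.
by move/eqP; rewrite eq_sym oner_eq0.
Qed.

Let VR := prod_topology (fun _ : V => R).

Lemma continuous_scale (T : topologicalType) (c : R) (a : T -> R) :
  continuous a -> continuous (fun x => c * a x).
Proof. by move=> ca x; apply: cvgMl_tmp; exact: ca. Qed.

Lemma continuous_add (T : topologicalType) (a b : T -> R) :
  continuous a -> continuous b -> continuous (fun x => a x + b x).
Proof. by move=> ca cb x; apply: cvgD; [exact: ca|exact: cb]. Qed.

Lemma continuous_at_div (T : topologicalType) (a b : T -> R) x :
  continuous a -> continuous b -> b x != 0 ->
  {for x, continuous (fun y => a y / b y)}.
Proof. by move=> ca cb b0; apply: cvgM; [exact: ca|apply: cvgV => //; exact: cb]. Qed.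

Lemma continuous_sum (T : topologicalType) (I : Type) (s : seq I) (P : pred I)
    (a : I -> T -> R) :
  (forall i, continuous (a i)) -> continuous (fun x => \sum_(i <- s | P i) a i x).
Proof. by move=> ca; apply: continuous_big => //; exact: add_continuous. Qed.

Lemma continuous_wsum (T : topologicalType) (I : Type) (s : seq I) (P : pred I)
    (w : I -> R) (a : I -> T -> R) :
  (forall i, continuous (a i)) ->
  continuous (fun x => \sum_(i <- s | P i) w i * a i x).
Proof.
by move=> ca; apply: continuous_sum => i; apply: continuous_scale; exact: ca.
Qed.

Lemma continuous_coord_norm_powR u : continuous (fun f : VR => `|f u| `^ p).
Proof.
move=> f; apply: (@continuous_comp VR R R (fun f => f u) (fun y => `|y| `^ p)).
  exact: proj_continuous.
exact: continuous_norm_powR.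
Qed.

Lemma continuous_diff_norm_powR u v :
  continuous (fun f : VR => `|f u - f v| `^ p).
Proof.
move=> f; apply: (@continuous_comp VR R R (fun f => f u - f v) (fun y => `|y| `^ p)).
  by apply: continuousB; exact: proj_continuous.
exact: continuous_norm_powR.
Qed.

(** The sphere is closed for the product topology and contained in the cube
    [[-1, 1] ^ V], which is compact by Tychonoff. *)
Lemma compact_Sp : compact (Sp p : set VR).
Proof.
have cub : compact [set f : VR | forall u, `[(-1 : R), 1]%classic (f u)].
  apply: (@tychonoff V (fun=> R) (fun=> `[(-1 : R), 1]%classic)) => _.
  exact: segment_compact.
have SpP : Sp p = (fun f : VR => \sum_u 1 * `|f u| `^ p) @^-1` [set 1].
  apply/seteqP; split=> f; rewrite /preimage/=.
    by move=> /SpE fS; under eq_bigr do rewrite mul1r.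
  by under eq_bigr do rewrite mul1r; move=> /SpE.
apply: (subclosed_compact _ cub).
  rewrite SpP; apply: (preimage_closed _ (@closed_eq _ 1)).
  by move=> f _; apply: continuous_wsum => u; exact: continuous_coord_norm_powR.
move=> f /SpE fS u /=; rewrite in_itv/= -ler_norml leNgt; apply/negP => fu1.
have fuS : `|f u| `^ p <= 1.
  by rewrite -fS (bigD1 u)//= lerDl sumr_ge0// => v _; exact: powR_ge0.
have : 1 `^ p < `|f u| `^ p by rewrite gt0_ltr_powR ?nnegrE.
by rewrite powR1 ltNge fuS.
Qed.

Section Rayleigh.
Context (G : weighted_graph R V) (kappa : V -> R).

Let N (f : VR) := edge_energy G p f + \sum_u kappa u * `|f u| `^ p.
Let D (f : VR) := \sum_u rho G u * `|f u| `^ p.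

Let cE : continuous (edge_energy G p : VR -> R).
Proof.
apply: (continuous_scale (T := VR)).
apply: (continuous_sum (T := VR)) => u; apply: continuous_sum => v.
apply: continuous_scale; exact: continuous_diff_norm_powR.
Qed.

Let cD : continuous D.
Proof. by apply: continuous_wsum => u; exact: continuous_coord_norm_powR. Qed.

Let cN : continuous N.
Proof.
have cK : continuous (fun f : VR => \sum_u kappa u * `|f u| `^ p).
  by apply: continuous_wsum => u; exact: continuous_coord_norm_powR.
exact: (continuous_add cE cK).
Qed.

Lemma rayleigh_min : (0 < #|V|)%N ->
  exists2 f, Sp p f & forall g, Sp p g -> rayleigh G kappa p f <= rayleigh G kappa p g.
Proof.
move=> /card_gt0P[u0 _].
have Sp0 : (Sp p : set VR) !=set0.
  have /normalize[c _ Sc] : (fun _ : V => 1 : R) <> (fun=> 0).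
    by move/(congr1 (fun h => h u0))/eqP; rewrite oner_eq0.
  by exists (fun=> c * 1).
have cR : {within (Sp p : set VR), continuous (rayleigh G kappa p : VR -> R)}.
  apply: continuous_in_subspaceT => f /set_mem Sf.
  have D0 : D f != 0.
    by rewrite gt_eqF// sum_norm_powR_gt0//; [exact: rho_gt0|exact: Sp_neq0].
  exact: (continuous_at_div cN cD).
have [f /set_mem Sf fmin] := compact_EVT_min Sp0 compact_Sp cR.
by exists f => // g Sg; apply: fmin; apply/mem_set.
Qed.

End Rayleigh.
End Sphere.

(** * The first eigenvalue *)

Section FirstEigenvalue.
Context {R : realType} {V : finType} (G : weighted_graph R V).
Context (kappa : V -> R) (p : R) (hp : 1 < p) (hG : connected_graph G).
Implicit Types (f g : V -> R) (lam : R).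

Lemma eigenfunction_residual lam f : eigenfunction G kappa p lam f <->
  f <> (fun=> 0) /\ forall u, residual G kappa p lam f u = 0.
Proof.
split=> -[fn0 H]; split=> // u; first by rewrite /residual H subrr.
by apply/eqP; rewrite -subr_eq0; apply/eqP; exact: H.
Qed.

Lemma eigenfunction_excess lam f : eigenfunction G kappa p lam f ->
  excess G kappa p lam f = 0.
Proof.
move=> /eigenfunction_residual[_ res0]; rewrite excess_residual// big1// => u _.
by rewrite res0 mul0r.
Qed.

Lemma excess_rayleigh lam f : f <> (fun=> 0) ->
  excess G kappa p lam f =
  (rayleigh G kappa p f - lam) * \sum_u rho G u * `|f u| `^ p.
Proof.
move=> fn0; have D0 := sum_norm_powR_gt0 p (rho_gt0 G) fn0.
by rewrite mulrBl /rayleigh divfK ?gt_eqF.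
Qed.

Lemma lambda1_min :
  (exists2 f, Sp p f & rayleigh G kappa p f = lambda1 G kappa p) /\
  (forall f, Sp p f -> lambda1 G kappa p <= rayleigh G kappa p f).
Proof.
have [f Sf fmin] := rayleigh_min hp G kappa hG.1.
have lb : lbound (rayleigh G kappa p @` Sp p) (rayleigh G kappa p f).
  by move=> _ [g Sg <-]; exact: fmin.
suff E : rayleigh G kappa p f = lambda1 G kappa p.
  by split=> [|g Sg]; [exists f|rewrite -E fmin].
apply/eqP; rewrite eq_le; apply/andP; split.
  by apply: lb_le_inf => //; exists (rayleigh G kappa p f); exists f.
by apply: ge_inf; [exists (rayleigh G kappa p f)|exists f].
Qed.

Lemma excess_lambda1_ge0 f : 0 <= excess G kappa p (lambda1 G kappa p) f.
Proof.
have [->|/eqP fn0] := eqVneq f (fun=> 0).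
  by rewrite excess_residual// big1// => u _; rewrite mulr0.
have [c c0 Sc] := normalize hp fn0.
have cp0 : 0 < `|c| `^ p by rewrite powR_gt0// normr_gt0 gt_eqF.
rewrite -(pmulr_rge0 _ cp0) -excess_scale// excess_rayleigh; last exact: Sp_neq0 Sc.
rewrite mulr_ge0 ?subr_ge0 ?lambda1_min.2//.
by rewrite sumr_ge0// => u _; rewrite mulr_ge0 ?powR_ge0// ltW// rho_gt0.
Qed.

(** The Picone argument applied to the positive ground states [|f|] and [|g|]
    makes them proportional, normalization makes them equal, and the constancy
    of signs recovers [f] and [g] from their absolute values. *)
Lemma ground_unique lam f g : (forall h, 0 <= excess G kappa p lam h) ->
  Sp p f -> Sp p g -> excess G kappa p lam f = 0 -> excess G kappa p lam g = 0 ->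
  g = f \/ g = (fun u => - f u).
Proof.
move=> lam_min Sf Sg f0 g0.
have [fn0 gn0] := (Sp_neq0 hp Sf, Sp_neq0 hp Sg).
have absg_gt0 u : 0 < `|g u| by rewrite normr_gt0 (ground_neq0 hp hG lam_min gn0 g0).
have absg_res := excess_min_residual hp lam_min (ground_norm hp lam_min g0).
have ratio := positive_excess_eq0 hp hG absg_gt0 absg_res
  (fun u => normr_ge0 (f u)) (ground_norm hp lam_min f0).
have [u0 _] : exists u : V, true by have [/card_gt0P[u]] := hG; exists u.
pose c := `|f u0| / `|g u0|.
have fE u : `|f u| = c * `|g u| by rewrite /c (ratio u0 u) divfK ?gt_eqF.
have c0 : 0 <= c by rewrite divr_ge0.
have cp1 : c `^ p = 1.
  move/(SpE hp): Sf; under eq_bigr do rewrite fE powRM//.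
  by rewrite -mulr_sumr; move/(SpE hp): Sg => ->; rewrite mulr1.
have c1 : c = 1.
  apply: (@powR_injective _ p); rewrite ?nnegrE//; first by move: hp; lra.
  by rewrite cp1 powR1.
have {fE}fE u : `|f u| = `|g u| by rewrite fE c1 mul1r.
have [fp|fm] := ground_sign hp hG lam_min fn0 f0;
  have [gp|gm] := ground_sign hp hG lam_min gn0 g0.
- by left; apply/funext => u; rewrite -(gtr0_norm (gp u)) -fE gtr0_norm.
- right; apply/funext => u; apply: oppr_inj; rewrite opprK.
  by rewrite -(gtr0_norm (gm u)) normrN -fE gtr0_norm.
- by right; apply/funext => u; rewrite -(gtr0_norm (gp u)) -fE -normrN gtr0_norm.
- left; apply/funext => u; apply: oppr_inj.
  by rewrite -(gtr0_norm (gm u)) normrN -fE -normrN gtr0_norm.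
Qed.

End FirstEigenvalue.

(* The first conjunct says that the infimum defining [lambda1] is a minimum. *)
Theorem theorem4p1 (R : realType) (V : finType) (G : weighted_graph R V)
    (kappa : V -> R) (p : R) (hp : 1 < p) (hG : connected_graph G) :
  [/\ (exists2 f, Sp p f & rayleigh G kappa p f = lambda1 G kappa p) /\
      (forall f, Sp p f -> lambda1 G kappa p <= rayleigh G kappa p f),
      simple_eigenvalue G kappa p (lambda1 G kappa p) /\
      (forall f, eigenfunction G kappa p (lambda1 G kappa p) f ->
         (forall u, 0 < f u) \/ (forall u, 0 < - f u)) &
      forall (lambda : R) (g : V -> R), eigenfunction G kappa p lambda g ->
        (forall u, 0 < g u) -> lambda = lambda1 G kappa p].
Proof.
have [[f1 Sf1 f1E] rmin] := lambda1_min kappa hp hG.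
have ge0 := excess_lambda1_ge0 kappa hp hG.
have f1n0 := Sp_neq0 hp Sf1.
have f10 : excess G kappa p (lambda1 G kappa p) f1 = 0.
  by rewrite excess_rayleigh// f1E subrr mul0r.
split.
- by split=> //; exists f1.
- split.
    exists f1; split=> //.
      by apply/eigenfunction_residual; split=> //; exact: excess_min_residual.
    by move=> g Sg /(eigenfunction_excess hp); exact: (ground_unique hp hG ge0).
  move=> f ef; apply: (ground_sign hp hG ge0 ef.1); exact: eigenfunction_excess.
- move=> lam g eg g_gt0; have gn0 := eg.1.
  have D0 (f : V -> R) : f <> (fun=> 0) -> 0 < \sum_u rho G u * `|f u| `^ p.
    exact: (sum_norm_powR_gt0 p (rho_gt0 G)).
  have [_ g_res] := (eigenfunction_residual G kappa p lam g).1 eg.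
  (* [excess lam f1 >= 0] bounds [lam] above, [excess lambda1 g >= 0] bounds it
     below, since [lam] is the Rayleigh quotient of [g]. *)
  apply/eqP; rewrite eq_le; apply/andP; split.
    have := positive_excess_ge0 hp g_gt0 g_res f1.
    by rewrite excess_rayleigh// f1E pmulr_lge0 ?D0// subr_ge0.
  have := eigenfunction_excess hp eg; rewrite excess_rayleigh// => /eqP.
  rewrite mulf_eq0 (gt_eqF (D0 g gn0)) orbF subr_eq0 => /eqP <-.
  by have := ge0 g; rewrite excess_rayleigh// pmulr_lge0 ?D0// subr_ge0.
Qed.
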